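(* Let $b_1,b_2\in[0,1]$ and $n\in\mathbb{Z}_{\ge1}$. Let $\pi=\big\{\{1,\dots,r_1\},\{r_1+1,\dots,r_2\},\dots,\{r_{m-1}+1,\dots,r_m\}\big\}$ be a partition of $\{1,\dots,n\}$ into $m$ consecutive blocks, where $m\le n$ and $1\le r_1<r_2<\dots<r_m=n$. Fix $\mathfrak{i},\mathfrak{j},\mathfrak{k},\mathfrak{l}\in\{0,1\}^m$. For all $\mathbf{i},\mathbf{j}\in\{0,1\}^n$ satisfying $g_\pi(\mathbf{i})=\mathfrak{i}$ and $g_\pi(\mathbf{j})=\mathfrak{j}$, we have $$\sum_{\substack{\mathbf{k},\mathbf{l}\in\{0,1\}^n:\\ g_\pi(\mathbf{k})=\mathfrak{k},\ g_\pi(\mathbf{l})=\mathfrak{l}}}\mathsf{L}^n(\mathbf{i},\mathbf{j};\mathbf{k},\mathbf{l})=\mathsf{L}^m(\mathfrak{i},\mathfrak{j};\mathfrak{k},\mathfrak{l}).$$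
   Context: With $r_0=0$, the projection $g_\pi:\{0,1\}^n\to\{0,1\}^m$ is $g_\pi(x_1,\dots,x_n)=\Big(\big(\sum_{i=r_{k-1}+1}^{r_k}x_i\big)\bmod 2\Big)_{k=1}^m$. Boolean-type product. Regard $b_1,b_2$ as indeterminates and let $W'=\{0,1,b_1,b_2,1-b_1,1-b_2\}$ and $W=W'\cup\{b_1b_2,\,b_1(1-b_2),\,(1-b_1)b_2,\,(1-b_1)(1-b_2)\}$. For $x\in W$ let $[x]$ be its set of factors: $[x]=\{x\}$ if $x\in W'$, $[b_1b_2]=\{b_1,b_2\}$, $[b_1(1-b_2)]=\{b_1,1-b_2\}$, $[(1-b_1)b_2]=\{1-b_1,b_2\}$, $[(1-b_1)(1-b_2)]=\{1-b_1,1-b_2\}$. For $x,y\in W$ set $x*y=0$ if $\{b_1,1-b_1\}\subseteq[x]\cup[y]$ or $\{b_2,1-b_2\}\subseteq[x]\cup[y]$, and $x*y=\prod_{z\in[x]\cup[y]}z$ otherwise. The product $*$ is commutative and associative on $W$; $\prod^*$ denotes the product of several terms under $*$. Matrix $\mathsf{L}^1$ (indexed by $i,j,k,l\in\{0,1\}$, the numbers of lines at the bottom, left, top, right of a vertex): $\mathsf{L}^1(1,0;1,0)=1$, $\mathsf{L}^1(0,1;0,1)=1$, $\mathsf{L}^1(0,0;0,0)=b_2$, $\mathsf{L}^1(0,0;1,1)=1-b_2$, $\mathsf{L}^1(1,1;1,1)=b_1$, $\mathsf{L}^1(1,1;0,0)=1-b_1$, and all other entries are $0$. For $\mathbf{x}\in\{0,1\}^n$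 and $r\in\{1,\dots,n\}$ let $\mathfrak{s}_r(\mathbf{x})=\big(\sum_{q=1}^r x_q\big)\bmod 2\in\{0,1\}$. For $\mathbf{i},\mathbf{j},\mathbf{k},\mathbf{l}\in\{0,1\}^n$ define $$\mathsf{L}^n(\mathbf{i},\mathbf{j};\mathbf{k},\mathbf{l})=\prod^{*}_{r\in\{1,\dots,n\}}\mathsf{L}^1\big(\mathfrak{s}_r(\mathbf{i}),\mathfrak{s}_r(\mathbf{j});\mathfrak{s}_r(\mathbf{k}),\mathfrak{s}_r(\mathbf{l})\big)\in W;$$ the product $*$ is computed formally in $W$, and the resulting element is then evaluated at the given numbers $b_1,b_2\in[0,1]$. *)

(* Defs.v *)
From HB Require Import structures.
From mathcomp Require Import all_boot all_order all_algebra.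

Set Implicit Arguments.
Unset Strict Implicit.
Unset Printing Implicit Defensive.

Import Order.TTheory GRing.Theory Num.Theory.
Local Open Scope ring_scope.

(** The set {0,1}^n is [{ffun 'I_n -> bool}]; the index [q : 'I_n] stands for
    the 1-based index q+1. *)

(** The ten formal expressions of W in the indeterminates b1, b2; the letter
    [c] abbreviates a complement, so [Wc1] is 1-b1 and [Wb1c2] is b1(1-b2).
    The first six constructors are the elements of W'. *)
Inductive W : predArgType :=
  | W0 | W1 | Wb1 | Wb2 | Wc1 | Wc2
  | Wb1b2 | Wb1c2 | Wc1b2 | Wc1c2.

(** [None] codes 0; otherwise each component tells whether bi (true), 1-bi
    (false) or neither of them occurs. *)
Definition W_code (w : W) : option (option bool * option bool) :=
  match w with
  | W0 => None
  | W1 => Some (None, None)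
  | Wb1 => Some (Some true, None)
  | Wb2 => Some (None, Some true)
  | Wc1 => Some (Some false, None)
  | Wc2 => Some (None, Some false)
  | Wb1b2 => Some (Some true, Some true)
  | Wb1c2 => Some (Some true, Some false)
  | Wc1b2 => Some (Some false, Some true)
  | Wc1c2 => Some (Some false, Some false)
  end.

Definition W_decode (c : option (option bool * option bool)) : W :=
  match c with
  | None => W0
  | Some (None, None) => W1
  | Some (Some true, None) => Wb1
  | Some (None, Some true) => Wb2
  | Some (Some false, None) => Wc1
  | Some (None, Some false) => Wc2
  | Some (Some true, Some true) => Wb1b2
  | Some (Some true, Some false) => Wb1c2
  | Some (Some false, Some true) => Wc1b2
  | Some (Some false, Some false) => Wc1c2
  end.

Lemma W_codeK : cancel W_code W_decode.
Proof. by case. Qed.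

HB.instance Definition _ := Finite.copy W (can_type W_codeK).

Definition Weval (R : comPzRingType) (b1 b2 : R) (w : W) : R :=
  match w with
  | W0 => 0
  | W1 => 1
  | Wb1 => b1
  | Wb2 => b2
  | Wc1 => 1 - b1
  | Wc2 => 1 - b2
  | Wb1b2 => b1 * b2
  | Wb1c2 => b1 * (1 - b2)
  | Wc1b2 => (1 - b1) * b2
  | Wc1c2 => (1 - b1) * (1 - b2)
  end.

Definition Wfactors (w : W) : {set W} :=
  match w with
  | Wb1b2 => [set Wb1; Wb2]
  | Wb1c2 => [set Wb1; Wc2]
  | Wc1b2 => [set Wc1; Wb2]
  | Wc1c2 => [set Wc1; Wc2]
  | _ => [set w]
  end.

Definition Wclash (S : {set W}) : bool :=
  ([set Wb1; Wc1] \subset S) || ([set Wb2; Wc2] \subset S).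

(** The element of W equal to the product of the members of [S], for [S] a
    set of elements of W' without clash; [Weval_prod] shows that it is this
    product, as an identity over any commutative ring (in particular over the
    polynomials in b1 and b2). *)
Definition Wprod (S : {set W}) : W :=
  if W0 \in S then W0
  else if Wb1 \in S then
    if Wb2 \in S then Wb1b2 else if Wc2 \in S then Wb1c2 else Wb1
  else if Wc1 \in S then
    if Wb2 \in S then Wc1b2 else if Wc2 \in S then Wc1c2 else Wc1
  else
    if Wb2 \in S then Wb2 else if Wc2 \in S then Wc2 else W1.

Definition Wstar (x y : W) : W :=
  let S := Wfactors x :|: Wfactors y in
  if Wclash S then W0 else Wprod S.

Lemma big_W (R : comPzRingType) (P : pred W) (F : W -> R) :
  \prod_(w | P w) F w =
  \prod_(w <- [:: W0; W1; Wb1; Wc1; Wb2; Wc2; Wb1b2; Wb1c2; Wc1b2; Wc1c2]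
           | P w) F w.
Proof.
apply: perm_big; apply: uniq_perm; [exact: index_enum_uniq | by [] |].
by move=> w; rewrite mem_index_enum; case: w.
Qed.

Lemma in_Wfactors (x z : W) :
  (z \in Wfactors x) =
  (z \in match x with
         | Wb1b2 => [:: Wb1; Wb2]
         | Wb1c2 => [:: Wb1; Wc2]
         | Wc1b2 => [:: Wc1; Wb2]
         | Wc1c2 => [:: Wc1; Wc2]
         | _ => [:: x]
         end).
Proof. by case: x; rewrite /Wfactors ?in_set2 ?in_set1 !inE. Qed.

Lemma Weval_prod (R : comPzRingType) (b1 b2 : R) (x y : W) :
  ~~ Wclash (Wfactors x :|: Wfactors y) ->
  Weval b1 b2 (Wprod (Wfactors x :|: Wfactors y)) =
  \prod_(z in Wfactors x :|: Wfactors y) Weval b1 b2 z.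
Proof.
rewrite big_W /Wclash /Wprod !subUset !sub1set.
under eq_bigl => w do rewrite in_setU !in_Wfactors.
rewrite !in_setU !in_Wfactors unlock.
by case: x; case: y => //= _; rewrite ?(mul0r, mulr0, mul1r, mulr1).
Qed.

Lemma Wstar_code (x y : W) :
  let merge (u v : option bool) :=
    match u, v with
    | None, w | w, None => Some w
    | Some a, Some b => if a == b then Some u else None
    end in
  Wstar x y = W_decode
    match W_code x, W_code y with
    | Some (u1, u2), Some (v1, v2) =>
      match merge u1 v1, merge u2 v2 with
      | Some w1, Some w2 => Some (w1, w2)
      | _, _ => None
      end
    | _, _ => None
    end.
Proof.
rewrite /Wstar /Wclash /Wprod !subUset !sub1set !in_setU !in_Wfactors.
by case: x; case: y.
Qed.

Lemma WstarA : associative Wstar.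
Proof. by move=> x y z; rewrite !Wstar_code; case: x; case: y; case: z. Qed.

Lemma WstarC : commutative Wstar.
Proof. by move=> x y; rewrite !Wstar_code; case: x; case: y. Qed.

Lemma Wstar1 : left_id W1 Wstar.
Proof. by move=> x; rewrite Wstar_code; case: x. Qed.

HB.instance Definition _ := Monoid.isComLaw.Build W W1 Wstar WstarA WstarC Wstar1.

(** Arguments: bottom, left; top, right. *)
Definition L1 (i j k l : bool) : W :=
  match i, j, k, l with
  | true,  false, true,  false => W1
  | false, true,  false, true  => W1
  | false, false, false, false => Wb2
  | false, false, true,  true  => Wc2
  | true,  true,  true,  true  => Wb1
  | true,  true,  false, false => Wc1
  | _, _, _, _ => W0
  end.

Definition parity_sum (n : nat) (x : {ffun 'I_n -> bool}) (r : 'I_n) : bool :=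
  odd (\sum_(q < n | (q <= r)%N) (x q : nat))%N.

Definition Ln (n : nat) (i j k l : {ffun 'I_n -> bool}) : W :=
  \big[Wstar/W1]_(r < n)
    L1 (parity_sum i r) (parity_sum j r) (parity_sum k r) (parity_sum l r).

(** A partition of {1,...,n} into m consecutive blocks is given by its right
    endpoints r = (r_1, ..., r_m), with 0 = r_0 < r_1 < ... < r_m = n. *)
Definition block_ends (n m : nat) (r : m.-tuple nat) : Prop :=
  path ltn 0%N r /\ last 0%N r = n.

(** The 0-based block k is r_k <= q < r_(k+1), where [nth 0 (0 :: r) k] is r_k
    and [nth 0 r k] is r_(k+1). *)
Definition in_block (m : nat) (r : m.-tuple nat) (k : 'I_m) (q : nat) : bool :=
  (nth 0 (0 :: r) k <= q < nth 0 r k)%N.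

Definition gproj (n m : nat) (r : m.-tuple nat) (x : {ffun 'I_n -> bool}) :
    {ffun 'I_m -> bool} :=
  [ffun k : 'I_m => odd (\sum_(q < n | in_block r k q) (x q : nat))%N].

(* Main.v *)
Require Import Defs.
From mathcomp Require Import all_boot all_order all_algebra.
From mathcomp Require Import ring.
Import Order.TTheory GRing.Theory Num.Theory.
Local Open Scope ring_scope.

(** The letters b1 and b2 behave like independent events of probabilities b1
    and b2: a formal product in [W] is the intersection of its factors, the
    idempotent product [Wstar] is intersection of events ([b1 * (1-b1)] is
    empty, [b1 * b1] is [b1]), and evaluating at [b1], [b2] is taking the
    probability.  Conditioning on which of the two events happen writes
    [Weval b1 b2] as a combination, with weights independent of the element of
    [W], of the four evaluations at 0/1 values ([Weval_expectation]).  Both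
    sides of the identity are sums of values of [Weval b1 b2], so it suffices
    to treat 0/1 values, where [Weval] turns [Wstar] into the ordinary product
    ([WevalM]).

    The map from x to its partial parities s_1(x), ..., s_n(x) is a bijection
    of {0,1}^n, and the partial parities of the projection of x are those of x
    at the right ends of the blocks ([parity_sum_gproj]).  In the new variables
    the sum therefore runs over all pairs of sequences whose values at the
    block ends are prescribed and whose other values are free.  At 0/1 values
    the summand is a product over the positions, so the sum factors: a block
    end gives the corresponding entry of the right-hand side, and any other
    position gives the sum of a row of L^1, which is 1 ([sum_L1]). *)

(** * Evaluation as an expectation *)

Lemma Weval_expectation {R : comNzRingType} (b1 b2 : R) (w : W) :
  Weval b1 b2 w =
  \sum_(e1 : bool) \sum_(e2 : bool)
    (if e1 then b1 else 1 - b1) * (if e2 then b2 else 1 - b2)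
      * Weval e1%:R e2%:R w.
Proof. by rewrite !big_bool /=; case: w => /=; ring. Qed.

(** The values 0 and 1 are idempotent, as [Wstar Wb1 Wb1 = Wb1] and
    [Wstar Wb1 Wc1 = W0] require of the value of b1. *)
Lemma WevalM {R : comNzRingType} (e1 e2 : bool) (x y : W) :
  Weval e1%:R e2%:R (Wstar x y)
  = Weval e1%:R e2%:R x * Weval e1%:R e2%:R y :> R.
Proof.
by rewrite Wstar_code; case: e1; case: e2; case: x; case: y => /=; ring.
Qed.

Lemma sum_L1 {R : comNzRingType} (b1 b2 : R) (i j : bool) :
  \sum_(k : bool) \sum_(l : bool) Weval b1 b2 (L1 i j k l) = 1.
Proof. by rewrite !big_bool; case: i; case: j => /=; ring. Qed.

(** * Summing out free coordinates *)

(** The sum factors over the coordinates; a coordinate in the image of [h]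
    keeps one term, and each of the others contributes 1. *)
Lemma sum_prod_free {R : comNzRingType} {A B U V : finType} (h : B -> A)
    (F : A -> U -> V -> R) (f : B -> U) (g : B -> V) :
  injective h -> (forall a, \sum_u \sum_v F a u v = 1) ->
  \sum_(k : {ffun A -> U} | [forall c, k (h c) == f c])
    \sum_(l : {ffun A -> V} | [forall c, l (h c) == g c])
      \prod_a F a (k a) (l a)
  = \prod_c F (h c) (f c) (g c).
Proof.
move=> h_inj F1.
pose admissible (T : finType) (p : B -> T) a t :=
  [forall c, (h c == a) ==> (t == p c)].
have famE (T : finType) (p : B -> T) (k : {ffun A -> T}) :
    [forall c, k (h c) == p c] = (k \in family (admissible T p)).
  apply/forallP/familyP => [kp a | kp c].
    by apply/forallP => c; apply/implyP => /eqP <-.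
  by have /forallP/(_ c) := kp (h c); rewrite eqxx.
have admE (T : finType) (p : B -> T) c t : admissible T p (h c) t = (t == p c).
  apply/forallP/eqP => [/(_ c)|-> d]; first by rewrite eqxx => /eqP.
  by apply/implyP => /eqP/h_inj ->.
have admT (T : finType) (p : B -> T) a t :
    a \notin codom h -> admissible T p a t.
  move=> ah; apply/forallP => c; apply/implyP => /eqP hc.
  by rewrite -hc codom_f in ah.
transitivity (\prod_a \sum_(u | admissible U f a u)
                      \sum_(v | admissible V g a v) F a u v).
  rewrite bigA_distr_big_dep; apply: eq_big => [k|k _]; first exact: famE.
  by rewrite bigA_distr_big_dep; apply: eq_bigl => l; rewrite famE.
rewrite (bigID (mem (codom h))) /= [X in _ * X]big1 ?mulr1; last first.
  move=> a ah; rewrite -(F1 a); apply: eq_big => [u|u _]; first exact: admT.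
  by apply: eq_bigl => v; apply: admT.
have codom_uniq : uniq (codom h).
  by rewrite map_inj_uniq ?enum_uniq.
rewrite -(big_uniq _ codom_uniq) big_image.
apply: eq_bigr => c _; rewrite (big_pred1 (f c)) => [|u]; last exact: admE.
by rewrite (big_pred1 (g c)) // => v; apply: admE.
Qed.

(** * Partial parities *)

(** Indexing by the number [t] of summed entries, with [t = 0] allowed, makes
    the left end of the first block an ordinary case; [parity_sum x r] is
    convertible to [prefix_parity x r.+1]. *)
Definition prefix_parity {n : nat} (x : {ffun 'I_n -> bool}) (t : nat) : bool :=
  odd (\sum_(q < n | (q < t)%N) (x q : nat))%N.

Lemma prefix_parity0 {n : nat} (x : {ffun 'I_n -> bool}) :
  prefix_parity x 0 = false.
Proof. by rewrite /prefix_parity big_pred0. Qed.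

Lemma prefix_parity_cat {n : nat} (x : {ffun 'I_n -> bool}) {s t : nat} :
  (s <= t)%N ->
  prefix_parity x t
  = prefix_parity x s (+) odd (\sum_(q < n | (s <= q < t)%N) (x q : nat))%N.
Proof.
move=> le_st; rewrite /prefix_parity -oddD.
rewrite (bigID (fun q : 'I_n => (q < s)%N)) /=.
congr (odd (_ + _)%N); apply: eq_bigl => q; last by rewrite -leqNgt andbC.
by case: (ltnP q s) => [/leq_trans->|]; rewrite ?andbF.
Qed.

Lemma prefix_parityS {n : nat} (x : {ffun 'I_n -> bool}) (r : 'I_n) :
  prefix_parity x r.+1 = prefix_parity x r (+) x r.
Proof.
rewrite (prefix_parity_cat x (leqnSn r)); congr addb.
rewrite (big_pred1 r) ?oddb // => q.
by rewrite /= ltnS -eqn_leq eq_sym.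
Qed.

Lemma parity_sum_inj {n : nat} :
  injective (fun x : {ffun 'I_n -> bool} => [ffun r => parity_sum x r]).
Proof.
move=> x y /ffunP eq_xy; apply/ffunP => r.
have eq_prefix t : (t <= n)%N -> prefix_parity x t = prefix_parity y t.
  case: t => [|t] lt_tn; first by rewrite !prefix_parity0.
  by have := eq_xy (Ordinal lt_tn); rewrite !ffunE.
apply: (@addbI (prefix_parity x r)); rewrite -prefix_parityS.
by rewrite !eq_prefix ?prefix_parityS // ltnW.
Qed.

(** A block contributes the difference of the parities at its two ends, so
    the parities of the projection telescope. *)
Lemma prefix_parity_gproj {n m : nat} (r : m.-tuple nat)
    (x : {ffun 'I_n -> bool}) (t : nat) :
  path ltn 0%N r -> (t <= m)%N ->
  prefix_parity (gproj r x) t = prefix_parity x (nth 0%N (0%N :: r) t).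
Proof.
move=> r_incr; elim: t => [|t IHt] lt_tm; first by rewrite !prefix_parity0.
rewrite (prefix_parityS _ (Ordinal lt_tm)) /= IHt 1?ltnW // ffunE /in_block /=.
rewrite -prefix_parity_cat //.
by apply/ltnW/(pathP 0%N r_incr); rewrite size_tuple.
Qed.

(** The positions [h c], just before the right ends of the blocks, are the ones
    whose partial parities the projection keeps. *)
Lemma block_last_positions {n m : nat} {r : m.-tuple nat} :
  block_ends n r ->
  exists2 h : 'I_m -> 'I_n, injective h
    & forall (x : {ffun 'I_n -> bool}) c,
        parity_sum (gproj r x) c = parity_sum x (h c).
Proof.
case=> r_incr r_last.
have sorted_r : sorted ltn (0%N :: r) by [].
have lt_r a b : (a < b <= m)%N -> (nth 0 (0 :: r) a < nth 0 (0 :: r) b)%N.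
  case/andP=> lt_ab le_bm.
  have le_am := leq_trans (ltnW lt_ab) le_bm.
  by apply: (sorted_ltn_nth ltn_trans 0%N sorted_r); rewrite ?inE ?size_tuple.
have r_gt0 (c : 'I_m) : (0 < nth 0 r c)%N by exact: lt_r 0%N c.+1 (ltn_ord c).
have r_le (c : 'I_m) : (nth 0 r c <= n)%N.
  have -> : n = nth 0%N (0%N :: r) m.
    by rewrite -r_last (last_nth 0%N) size_tuple.
  rewrite -[nth 0 r c]/(nth 0 (0 :: r) c.+1)%N.
  have := ltn_ord c; rewrite leq_eqVlt => /orP[/eqP -> //|lt_cm].
  by apply/ltnW/(lt_r c.+1); rewrite lt_cm leqnn.
have h_lt (c : 'I_m) : ((nth 0 r c).-1 < n)%N by rewrite prednK.
exists (fun c => Ordinal (h_lt c)) => [c d [] eq_cd | x c]; last first.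
  rewrite -[LHS]/(prefix_parity _ c.+1) prefix_parity_gproj //=.
  by rewrite -[RHS]/(prefix_parity _ (nth 0%N r c).-1.+1) prednK.
have {}eq_cd : nth 0%N r c = nth 0%N r d.
  by rewrite -[LHS]prednK // eq_cd prednK.
apply: val_inj; case: (ltngtP c d) => // lt_cd.
  by have := lt_r c.+1 d.+1; rewrite /= eq_cd ltnn ltnS lt_cd ltn_ord => /(_ isT).
by have := lt_r d.+1 c.+1; rewrite /= eq_cd ltnn ltnS lt_cd ltn_ord => /(_ isT).
Qed.

(** * The identity *)

(** At 0/1 values the change of variables to partial parities turns the sum
    into one that factors over the positions. *)
Lemma sum_Ln_bool {R : comNzRingType} (e1 e2 : bool) {n m : nat}
    (r : m.-tuple nat) (K L : {ffun 'I_m -> bool}) (i j : {ffun 'I_n -> bool}) :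
  block_ends n r ->
  \sum_(k : {ffun 'I_n -> bool} | gproj r k == K)
    \sum_(l : {ffun 'I_n -> bool} | gproj r l == L)
      Weval e1%:R e2%:R (Ln i j k l)
  = Weval e1%:R e2%:R (Ln (gproj r i) (gproj r j) K L) :> R.
Proof.
move=> hr; have [h h_inj hE] := block_last_positions hr.
pose F a u v : R :=
  Weval e1%:R e2%:R (L1 (parity_sum i a) (parity_sum j a) u v).
have LnE p (x y z t : {ffun 'I_p -> bool}) :
    Weval e1%:R e2%:R (Ln x y z t)
    = \prod_a Weval e1%:R e2%:R
        (L1 (parity_sum x a) (parity_sum y a)
            (parity_sum z a) (parity_sum t a)) :> R.
  exact: (big_morph (Weval e1%:R e2%:R) (WevalM e1 e2) erefl).
(* Comparing partial parities instead of coordinates loses nothing, so the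
   constraint becomes one value of the new variable for each block. *)
have gprojE (k : {ffun 'I_n -> bool}) (M : {ffun 'I_m -> bool}) :
    (gproj r k == M)
    = [forall c, [ffun a => parity_sum k a] (h c) == parity_sum M c].
  apply/eqP/forallP => [<- c|kM]; first by rewrite ffunE hE.
  apply: parity_sum_inj; apply/ffunP => c; rewrite !ffunE hE.
  by have := kM c; rewrite ffunE => /eqP.
have F1 a : \sum_u \sum_v F a u v = 1 by apply: sum_L1.
transitivity (\prod_c F (h c) (parity_sum K c) (parity_sum L c)); last first.
  by rewrite LnE; apply: eq_bigr => c _; rewrite !hE.
rewrite -(sum_prod_free h F (parity_sum K) (parity_sum L) h_inj F1).
rewrite [RHS](reindex_inj parity_sum_inj) /=.
apply: eq_big => [k|k _]; first exact: gprojE.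
rewrite [RHS](reindex_inj parity_sum_inj) /=.
apply: eq_big => [l|l _]; first exact: gprojE.
by rewrite LnE; apply: eq_bigr => a _; rewrite !ffunE.
Qed.

Theorem proposition2p6 (R : realFieldType) (b1 b2 : R)
    (hb1 : 0 <= b1 <= 1) (hb2 : 0 <= b2 <= 1)
    (n m : nat) (n_gt0 : (1 <= n)%N) (le_mn : (m <= n)%N)
    (r : m.-tuple nat) (hr : block_ends n r)
    (I J K L : {ffun 'I_m -> bool}) (i j : {ffun 'I_n -> bool})
    (hi : gproj r i = I) (hj : gproj r j = J) :
  \sum_(k : {ffun 'I_n -> bool} | gproj r k == K)
    \sum_(l : {ffun 'I_n -> bool} | gproj r l == L)
      Weval b1 b2 (Ln i j k l)
  = Weval b1 b2 (Ln I J K L).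
Proof.
rewrite -hi -hj [RHS]Weval_expectation.
under eq_bigr => k _.
  under eq_bigr => l _ do rewrite Weval_expectation.
  rewrite exchange_big; over.
rewrite exchange_big; apply: eq_bigr => e1 _.
under eq_bigr => k _ do rewrite exchange_big.
rewrite exchange_big; apply: eq_bigr => e2 _.
rewrite -(sum_Ln_bool e1 e2 r K L i j hr) mulr_sumr.
by apply: eq_bigr => k _; rewrite mulr_sumr.
Qed.
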